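(* None of the groups $D_{2^n}$ ($n\geq 3$), $Q_{2^n}$ ($n\geq 3$), $S_{2^n}$ ($n\geq 4$) belongs to $\mathcal{C}$.
   Context: The groups are: the dihedral groups $D_{2^n}=\langle x,y\mid x^{2^{n-1}}=y^2=1,\ yxy^{-1}=x^{2^{n-1}-1}\rangle$, $n\geq 3$; the generalized quaternion groups $Q_{2^n}=\langle x,y\mid x^{2^{n-1}}=y^4=1,\ x^{2^{n-2}}=y^2,\ yxy^{-1}=x^{2^{n-1}-1}\rangle$, $n\geq 3$; the quasi-dihedral groups $S_{2^n}=\langle x,y\mid x^{2^{n-1}}=y^2=1,\ y^{-1}xy=x^{2^{n-2}-1}\rangle$, $n\geq 4$. Each has order $2^n$. For a finite group $G$, $L(G)$ denotes the set (lattice) of all subgroups of $G$. For $H\in L(G)$, the relative subgroup commutativity degree of $H$ in $G$ is $$sd(H,G)=\frac{1}{|L(H)||L(G)|}\left|\{(H_1,G_1)\in L(H)\times L(G) \mid H_1G_1=G_1H_1\}\right|.$$ Let $f:L(G)\to[0,1]$, $f(H)=sd(H,G)$. The class $\mathcal{C}$ consists of all finite groups $G$ for which $|\mathrm{Im}\, f|=2$, i.e. for which $f$ takes exactly two distinct values. *)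

(* Defs.v *)
From mathcomp Require Import all_boot all_order all_fingroup all_algebra.

Set Implicit Arguments.
Unset Strict Implicit.
Unset Printing Implicit Defensive.

Import GroupScope.

(* The products below are products of subsets, in group_scope; in Group_scope
   they would denote the generated subgroup and always commute. *)
Definition commuting_pairs (gT : finGroupType) (H G : {group gT}) :
    {set {group gT} * {group gT}} :=
  [set P in setX (subgroups H) (subgroups G)
     | ((P.1 : {set gT}) * P.2)%g == ((P.2 : {set gT}) * P.1)%g].

Definition sd (gT : finGroupType) (H G : {group gT}) : rat :=
  ((#|commuting_pairs H G|)%:R / (#|subgroups H| * #|subgroups G|)%:R)%R.

Definition sd_values (gT : finGroupType) (G : {group gT}) : seq rat :=
  undup [seq sd H G | H : {group gT} in subgroups G].

Definition class_C (gT : finGroupType) (G : {group gT}) : Prop :=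
  size (sd_values G) = 2.

(* Main.v *)
(* Let d(H) be the number of non-commuting pairs in L(H) x L(G). Since
   sd(H, G) = 1 - d(H) / (|L(H)| |L(G)|) and sd(1, G) = 1, membership in C
   forces d(H) / |L(H)| to be the same for all H with d(H) > 0.
   For n >= 4, G has exactly three maximal subgroups <x>, A and B, which
   pairwise meet in the Frattini subgroup F = <x^2>, and all subgroups of <x>
   are normal. Hence d(G) = d(A) + d(B), with both terms positive because <y>
   and <xy> do not commute, while |L(G)| = |L(A)| + |L(B)| + 2 - |L(F)|.
   Proportionality then gives |L(F)| = 2, whereas |L(F)| = n - 1.
   For n = 3 this count is not contradictory: in D_8 one compares <y> with the
   Klein group V = <y, x^2>, for which d(V) = 2 d(<y>) but |L(V)| = 5 and
   |L(<y>)| = 2, while all subgroups of Q_8 are normal, so f is constant. *)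

Require Import Defs.
From mathcomp Require Import all_boot all_order all_fingroup all_algebra.
From mathcomp Require Import all_solvable.

Set Implicit Arguments.
Unset Strict Implicit.
Unset Printing Implicit Defensive.

Import GroupScope.

(** * Non-commuting pairs and the commutativity degree *)

(** Its cardinality is the d(H) of the overview. Normal subgroups contribute nothing to this set,
    which is what makes it easier to count than its complement. *)
Definition noncommuting_pairs (gT : finGroupType) (H G : {group gT}) :
    {set {group gT} * {group gT}} :=
  setX (subgroups H) (subgroups G) :\: commuting_pairs H G.

Lemma in_noncommuting_pairs (gT : finGroupType) (H G K L : {group gT}) :
  ((K, L) \in noncommuting_pairs H G)
    = [&& K \subset H, L \subset G & K * L != L * K].
Proof. by rewrite !inE /=; do 2!case: (_ \subset _); rewrite ?andbF ?andbT. Qed.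

Lemma noncommuting_pairsS (gT : finGroupType) (H K G : {group gT}) :
  H \subset K -> noncommuting_pairs H G \subset noncommuting_pairs K G.
Proof.
move=> sHK; apply/subsetP=> -[A B]; rewrite !in_noncommuting_pairs.
by case/and3P=> sAH -> ->; rewrite (subset_trans sAH).
Qed.

Lemma normal_mulC (gT : finGroupType) (G K L : {group gT}) :
  K <| G -> L \subset G -> K * L = L * K.
Proof. by case/andP=> _ nKG sLG; rewrite (normC (subset_trans sLG nKG)). Qed.

Lemma card_subgroups_gt0 (gT : finGroupType) (G : {group gT}) :
  0 < #|subgroups G|.
Proof. by apply/card_gt0P; exists G; rewrite inE. Qed.

Lemma commuting_pairs_sub (gT : finGroupType) (H G : {group gT}) :
  commuting_pairs H G \subset setX (subgroups H) (subgroups G).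
Proof. by apply/subsetP=> P; rewrite inE => /andP[]. Qed.

Lemma sd_compl (gT : finGroupType) (H G : {group gT}) :
  (sd H G = 1 - (#|noncommuting_pairs H G|)%:R
                / (#|subgroups H| * #|subgroups G|)%:R)%R.
Proof.
have nz : ((#|subgroups H| * #|subgroups G|)%:R != 0 :> rat)%R.
  by rewrite Num.Theory.pnatr_eq0 -lt0n muln_gt0 !card_subgroups_gt0.
rewrite /sd -[X in (X - _)%R](GRing.divff nz) -GRing.mulrBl; congr (_ / _)%R.
rewrite -cardsX -(cardsID (commuting_pairs H G) (setX _ _)) GRing.natrD.
by rewrite (setIidPr (commuting_pairs_sub H G)) GRing.addrK.
Qed.

Lemma sd_eq1 (gT : finGroupType) (H G : {group gT}) :
  (sd H G == 1)%R = (noncommuting_pairs H G == set0).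
Proof.
rewrite sd_compl GRing.subr_eq -GRing.subr_eq0 GRing.opprD GRing.addNKr.
rewrite GRing.oppr_eq0 GRing.mulf_eq0 GRing.invr_eq0 !Num.Theory.pnatr_eq0.
by rewrite muln_eq0 !eqn0Ngt !card_subgroups_gt0 !orbF -eqn0Ngt cards_eq0.
Qed.

(** The common factor |L(G)| cancels; cross-multiplying keeps all later counting in [nat]. *)
Lemma sd_eq (gT : finGroupType) (H K G : {group gT}) : sd H G = sd K G ->
  (#|noncommuting_pairs H G| * #|subgroups K|
    = #|noncommuting_pairs K G| * #|subgroups H|)%N.
Proof.
have nz (L : {group gT}) : ((#|subgroups L|)%:R != 0 :> rat)%R.
  by rewrite Num.Theory.pnatr_eq0 -lt0n card_subgroups_gt0.
rewrite !sd_compl => /GRing.addrI/GRing.oppr_inj/eqP.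
rewrite !GRing.natrM GRing.eqr_div ?GRing.mulf_neq0 // !GRing.mulrA.
rewrite (inj_eq (GRing.mulIf (nz G))) -!GRing.natrM.
by rewrite Num.Theory.eqr_nat => /eqP.
Qed.

(** The trivial subgroup permutes with everything, so 1 is one of the two values. Subgroups with d >
    0 avoid the value 1 and must share the other one. *)
Lemma class_C_eq (gT : finGroupType) (G H K : {group gT}) :
    class_C G -> H \subset G -> K \subset G ->
    noncommuting_pairs H G != set0 -> noncommuting_pairs K G != set0 ->
  (#|noncommuting_pairs H G| * #|subgroups K|
    = #|noncommuting_pairs K G| * #|subgroups H|)%N.
Proof.
move=> CG sHG sKG ncH ncK; apply: sd_eq.
have mem_sd (L : {group gT}) : L \subset G -> sd L G \in sd_values G.
  by move=> sLG; rewrite mem_undup; apply/imageP; exists L; rewrite ?inE.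
have sd1 : sd [1 gT] G = 1%R.
  apply/eqP; rewrite sd_eq1; apply/eqP/setP=> -[A B].
  rewrite in_noncommuting_pairs inE; apply/and3P=> -[/trivgP-> _].
  by rewrite mul1g mulg1 eqxx.
have s1 := mem_sd [1 gT]%G (sub1G G); rewrite sd1 in s1.
have := mem_sd _ sHG; have := mem_sd _ sKG; move: s1.
have := undup_uniq [seq sd L G | L : {group gT} in subgroups G].
move: CG ncH ncK; rewrite /class_C -/(sd_values G) -!sd_eq1.
case: (sd_values G) => [|a [|b [|]]] // _ ncH ncK _; rewrite !inE.
case/pred2P=> e; rewrite -e (negPf ncH) (negPf ncK) ?orbF /=.
  by move=> /eqP-> /eqP->.
by move=> /eqP-> /eqP->.
Qed.

Lemma not_class_C_all_commute (gT : finGroupType) (G : {group gT}) :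
  noncommuting_pairs G G = set0 -> ~ class_C G.
Proof.
move=> nc0; have sd1 r : r \in sd_values G -> r = 1%R.
  rewrite mem_undup => /imageP[L]; rewrite inE => sLG ->.
  by apply/eqP; rewrite sd_eq1 -subset0 -nc0 noncommuting_pairsS.
have := undup_uniq [seq sd L G | L : {group gT} in subgroups G].
rewrite -/(sd_values G) /class_C => uG sz2; move: uG sd1 sz2.
case: (sd_values G) => [|a [|b [|c s]]] // uab sd1 _.
have a1 : a = 1%R by apply: sd1; apply: mem_head.
have b1 : b = 1%R by apply: sd1; rewrite inE mem_head orbT.
by move: uab; rewrite cons_uniq a1 b1 mem_head.
Qed.

(** * Counting over three maximal subgroups *)

(** A proper subgroup of C lies in F, hence in A, so L(G) is L(A) united with L(B) and the two
    further members G and C. Inclusion-exclusion applies because L(A) and L(B) meet in L(F). *)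
Lemma card_subgroups_cover (gT : finGroupType) (G A B C F : {group gT}) :
    A \proper G -> B \proper G -> C \proper G -> F \proper C ->
    A :&: B = F -> A :&: C = F -> B :&: C = F ->
    (forall K : {group gT}, K \proper G ->
      [|| K \subset A, K \subset B | K \subset C]) ->
    (forall K : {group gT}, K \proper C -> K \subset F) ->
  (#|subgroups G| + #|subgroups F| = #|subgroups A| + #|subgroups B| + 2)%N.
Proof.
move=> pA pB pC pF AB AC BC cov covC.
have nsub (K : {group gT}) : K :&: C = F -> ~~ (C \subset K).
  move/setP=> KC; have /properP[_ [c Cc F'c]] := pF.
  by apply: contra F'c => /subsetP/(_ c Cc); rewrite -KC inE Cc andbT.
have -> : subgroups F = subgroups A :&: subgroups B.
  by apply/setP=> K; rewrite !inE -subsetI AB.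
rewrite -[in RHS]cardsUI addnAC; congr (_ + _)%N.
have -> : subgroups G = (subgroups A :|: subgroups B) :|: [set G; C].
  apply/setP=> K; rewrite !inE; apply/idP/idP=> [sKG|].
    have [/eqP->|neKG] := boolP (K == G); first by rewrite !orbT.
    have /cov/or3P[->//|->|sKC] : K \proper G.
    - by rewrite properEneq sKG andbT; apply: contra neKG.
    - by rewrite orbT.
    have [/eqP->|neKC] := boolP (K == C); first by rewrite !orbT.
    have /covC : K \proper C.
      by rewrite properEneq sKC andbT; apply: contra neKC.
    by rewrite -AB subsetI => /andP[->].
  case/or3P=> [/orP[]|/eqP->|/eqP->] //; last exact: proper_sub.
    by move=> s; apply: subset_trans s (proper_sub _).
  by move=> s; apply: subset_trans s (proper_sub _).
rewrite cardsU cards2.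
have -> : G != C by apply: contraTneq pC => <-; rewrite properxx.
rewrite [_ :&: _](_ : _ = set0) ?cards0 ?subn0 //.
apply/setP=> K; rewrite !inE; apply/negP=> /andP[/orP[] s /pred2P[e|e]];
  rewrite {}e in s.
- by case/andP: pA; rewrite s.
- by case/negP: (nsub A AC).
- by case/andP: pB; rewrite s.
- by case/negP: (nsub B BC).
Qed.

(** The first member of a non-commuting pair is not normal, so it is proper and not inside C. It
    therefore lies in A or B, and not in both, since A and B meet inside C. *)
Lemma card_noncommuting_cover (gT : finGroupType) (G A B C : {group gT}) :
    A \subset G -> B \subset G -> A :&: B \subset C ->
    (forall K : {group gT}, K \proper G ->
      [|| K \subset A, K \subset B | K \subset C]) ->
    (forall K : {group gT}, K \subset C -> K <| G) ->
  #|noncommuting_pairs G G|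
    = (#|noncommuting_pairs A G| + #|noncommuting_pairs B G|)%N.
Proof.
move=> sAG sBG sAB cov nC.
have ncC (K L : {group gT}) :
    K \subset C -> L \subset G -> K * L != L * K -> False.
  by move=> /nC nKG sLG; rewrite (normal_mulC nKG sLG) eqxx.
rewrite -cardsUI [_ :&: _](_ : _ = set0).
  rewrite cards0 addn0; apply: eq_card; case=> K L.
  rewrite in_setU !in_noncommuting_pairs.
  apply/idP/idP=> [/and3P[sKG sLG ncKL]|].
    have /cov/or3P[->|->|/ncC] : K \proper G; last by move/(_ _ sLG ncKL).
    - rewrite properEneq sKG andbT; apply: contraNneq ncKL => KG.
      by rewrite (normal_mulC (G := G)) // KG normal_refl.
    - by rewrite sLG ncKL.
    - by rewrite sLG ncKL orbT.
  by case/orP=> /and3P[s -> ->]; rewrite (subset_trans s).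
apply/setP=> -[K L]; rewrite in_setI in_set0 !in_noncommuting_pairs; apply/negP.
case/andP=> /and3P[sKA sLG ncKL] /and3P[sKB _ _].
by apply: (ncC K L) => //; apply: subset_trans sAB; rewrite subsetI sKA.
Qed.

Lemma not_class_C_cover (gT : finGroupType) (G A B C F : {group gT}) :
    A \proper G -> B \proper G -> C \proper G -> F \proper C ->
    A :&: B = F -> A :&: C = F -> B :&: C = F ->
    (forall K : {group gT}, K \proper G ->
      [|| K \subset A, K \subset B | K \subset C]) ->
    (forall K : {group gT}, K \proper C -> K \subset F) ->
    (forall K : {group gT}, K \subset C -> K <| G) ->
    noncommuting_pairs A G != set0 -> noncommuting_pairs B G != set0 ->
    2 < #|subgroups F| ->
  ~ class_C G.
Proof.
move=> pA pB pC pF AB AC BC cov covC nC ncA ncB F3 CG.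
have [sAG sBG] := (proper_sub pA, proper_sub pB).
have ncG : noncommuting_pairs G G != set0.
  by apply: contraNneq ncA => e; rewrite -subset0 -e noncommuting_pairsS.
have eA := class_C_eq CG (subxx G) sAG ncG ncA.
have eB := class_C_eq CG (subxx G) sBG ncG ncB.
have cL := card_subgroups_cover pA pB pC pF AB AC BC cov covC.
have cN : #|noncommuting_pairs G G|
    = (#|noncommuting_pairs A G| + #|noncommuting_pairs B G|)%N.
  by apply: (card_noncommuting_cover (C := C)) => //; rewrite AB proper_sub.
(* Adding the two proportions gives d(G) (|L(A)| + |L(B)|) = (d(A) + d(B)) |L(G)|, and d(G) > 0
   cancels; the subgroup count then forces |L(F)| = 2. *)
have /eqP : (#|noncommuting_pairs G G| * (#|subgroups A| + #|subgroups B|)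
    = #|noncommuting_pairs G G| * #|subgroups G|)%N.
  by rewrite mulnDr eA eB -mulnDl -cN.
rewrite eqn_pmul2l ?card_gt0 // => /eqP cAB.
by move: F3; rewrite -(ltn_add2l #|subgroups G|) cL cAB ltnn.
Qed.

(** * Matching the presentations with the standard 2-groups *)

(** [\isog Grp] says that a group has the same finite homomorphic images as the presentation. Thus G
    and H are images of each other, which for finite groups means isomorphic. *)
Lemma isoGrp_isog (gT rT : finGroupType) (G : {group gT}) (H : {group rT}) p q :
    (forall (hT : finGroupType) (K : {group hT}),
      (K \homg Grp p) = (K \homg Grp q)) ->
  G \isog Grp p -> H \isog Grp q -> G \isog H.
Proof.
move=> eq_pq isoG isoH; rewrite isogEhom.
by rewrite [G \homg H]isoH -eq_pq -isoG [H \homg G]isoG eq_pq -isoH !homg_refl.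
Qed.

(** Here [x ^ y] is y^-1 x y, while the dihedral and quaternion relations conjugate by y^-1.
    Inversion is an involution, so both directions say the same. *)
Lemma conjgV_eq_inv (gT : finGroupType) (x y : gT) :
  (y * x * y^-1 == x^-1) = (x ^ y == x^-1).
Proof.
have -> : y * x * y^-1 = x ^ y^-1 by rewrite conjgE invgK mulgA.
by rewrite -(inj_eq (conjg_inj y)) conjgKV conjVg eq_sym eq_invg_sym.
Qed.

Lemma expg_order_pred (gT : finGroupType) (x : gT) m :
  0 < m -> x ^+ m = 1 -> x ^+ (m - 1) = x^-1.
Proof.
case: m => // m _; rewrite subSS subn0 expgSr => xm1.
by apply/eqP; rewrite eq_mulgV1 invgK xm1.
Qed.

Lemma isog_dihedral (gT : finGroupType) (G : {group gT}) n : 2 < n ->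
    G \isog Grp (x : y : x ^+ (2 ^ (n - 1)) = y ^+ 2 = 1,
                         y * x * y^-1 = x ^+ (2 ^ (n - 1) - 1)) ->
  G \isog 'D_(2 ^ n).
Proof.
move=> n_gt2 isoG; apply: isoGrp_isog isoG (Grp_2dihedral (ltnW n_gt2)).
move=> hT K; apply: eq_existsb => -[x y] /=; rewrite subn1 !xpair_eqE.
case: (_ == gval K) => //=.
case: eqP => [xN|] //=; case: eqP => //= _.
by rewrite (expg_order_pred _ xN) ?expn_gt0 // conjgV_eq_inv.
Qed.

Lemma isog_quaternion (gT : finGroupType) (G : {group gT}) n : 2 < n ->
    G \isog Grp (x : y : x ^+ (2 ^ (n - 1)) = y ^+ 4 = 1,
                         x ^+ (2 ^ (n - 2)) = y ^+ 2,
                         y * x * y^-1 = x ^+ (2 ^ (n - 1) - 1)) ->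
  G \isog 'Q_(2 ^ n).
Proof.
move=> n_gt2 isoG; apply: isoGrp_isog isoG (Grp_quaternion n_gt2).
move=> hT K; apply: eq_existsb => -[x y] /=; rewrite subn1 subn2 !xpair_eqE.
case: (_ == gval K) => //=.
case: eqP => [xN|] //=.
rewrite (expg_order_pred _ xN) ?expn_gt0 // conjgV_eq_inv [y ^+ 2 == _]eq_sym.
case: (x ^+ _ =P y ^+ 2) => [xr|]; last by rewrite andbF.
(* [Grp_quaternion] does not list y^4 = 1; it is recovered by squaring x^(2^(n-2)) = y^2. *)
have xr2 : y ^+ 4 = x ^+ (2 ^ n.-2 * 2) by rewrite expgM xr -expgM.
by rewrite xr2 -expnSr prednK -1?subn1 ?subn_gt0 ?(ltnW n_gt2) // subn1 xN eqxx.
Qed.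

Lemma isog_semidihedral (gT : finGroupType) (G : {group gT}) n : 3 < n ->
    G \isog Grp (x : y : x ^+ (2 ^ (n - 1)) = y ^+ 2 = 1,
                         y^-1 * x * y = x ^+ (2 ^ (n - 2) - 1)) ->
  G \isog 'SD_(2 ^ n).
Proof.
move=> n_gt3 isoG; apply: isoGrp_isog isoG (Grp_semidihedral n_gt3).
move=> hT K; apply: eq_existsb => -[x y] /=; rewrite subn1 subn2 !xpair_eqE.
by rewrite conjgE mulgA subn1.
Qed.

(** * Groups of order at least 16 *)

(** A product of permuting subgroups is a group; this one contains y and xy, hence also x. *)
Lemma cycle_mul_comm_sub (gT : finGroupType) (x y : gT) :
    <[y]> * <[x * y]> = <[x * y]> * <[y]> ->
  <[x]> * <[y]> \subset <[y]> * <[x * y]>.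
Proof.
move/(@comm_joingE _ <[y]>%G <[x * y]>%G) <-.
have yYK : y \in <[y]> <*> <[x * y]> by rewrite mem_gen // inE cycle_id.
rewrite mulG_subG !cycle_subG yYK andbT -(groupMr _ yYK).
by rewrite mem_gen // inE cycle_id orbT.
Qed.

(** Treats the three families together: the fourth-power hypotheses cover both order 2 and order 4
    for y and xy. *)
Lemma not_class_C_extremal (gT : finGroupType) (G : {group gT}) n x y :
    3 < n -> extremal_generators G 2 n (x, y) ->
    y ^+ 4 = 1 -> (x * y) ^+ 4 = 1 -> 'Phi(G) = <[x ^+ 2]> ->
    (forall M : {group gT},
      maximal M G = pred3 <[x]> <<y ^: G>> <<(x * y) ^: G>> M) ->
  ~ class_C G.
Proof.
case: n => [|[|[|[|m]]]] // _ genG y4 xy4 defPhi defmax.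
have [oG Gx ox X'y] := genG; have [Gy X_y] := setDP X'y.
have [pG maxX nsXG defXY _] := extremal_generators_facts (isT : prime 2) genG.
(* r is the order of x^2, so #[x] = 2r and |G| = 4r. Destructing a sigma type keeps r opaque to
   simplification. *)
have [r def_r] : {r | r = 2 ^ m.+2}%N by exists (2 ^ m.+2)%N.
have r_ge4 : 4 <= r by rewrite def_r -[4]/(2 ^ 2)%N leq_exp2l.
have r_gt0 : 0 < r by rewrite def_r expn_gt0.
have def2r : (2 ^ m.+4.-1 = 2 * r)%N by rewrite def_r -expnS.
have def2q : (2 ^ m.+4 = 2 * (2 * r))%N by rewrite def_r -!expnS.
rewrite def2r in ox.
have ox2 : #[x ^+ 2] = r by rewrite orderXdiv ox ?dvdn_mulr ?mulKn.
have oxr : #[x ^+ r] = 2 by rewrite orderXdiv ox ?dvdn_mull ?mulnK.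
have nsub (K : {group gT}) : K \subset <[x]> -> K <| G.
  by move=> sKX; apply: char_normal_trans nsXG; apply: cycle_subgroup_char.
set W := <[x ^+ r]>%G.
have nWG : G \subset 'N(W) by rewrite normal_norm ?nsub ?cycleX.
(* t ^+ 2 lies in the Frattini subgroup of G, hence in <[x]>, whose only
   subgroup of order 2 is W. *)
have sqW t : t \in G -> t ^+ 4 = 1 -> t ^+ 2 \in W.
  move=> Gt t4; have Xt2 : t ^+ 2 \in <[x]>.
    apply: (subsetP (cycleX x 2)); rewrite -defPhi (Phi_joing pG).
    apply: (subsetP (joing_subr _ _)); rewrite (MhoE 1 pG) mem_gen //.
    exact: imset_f.
  have: t ^+ 2 \in 'Ohm_1(<[x]>).
    by rewrite (OhmE _ (mem_p_elt pG Gx)) mem_gen // !inE Xt2 -expgM t4 /=.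
  rewrite (Ohm_p_cycle _ (mem_p_elt pG Gx)) ox -def2r pfactorK // subn1.
  by rewrite /W /= def_r.
have oqW t : t \in G -> t ^+ 4 = 1 -> #|<[t]> / W| <= 2.
  move=> Gt t4; have Nt := subsetP nWG t Gt.
  rewrite quotient_cycle // -orderE dvdn_leq // order_dvdn.
  by rewrite -morphX //= coset_id ?sqW.
have Gxy : x * y \in G by rewrite groupM.
(* Modulo W both factors have order at most 2, while |G / W| = 2 * r >= 8. *)
have ncYK : <[y]> * <[x * y]> <> <[x * y]> * <[y]>.
  move/cycle_mul_comm_sub; rewrite defXY.
  move/(quotientS W); rewrite quotientMl ?cycle_subG ?(subsetP nWG) //.
  move/subset_leq_card; rewrite leqNgt => /negP[].
  rewrite card_quotient // -divgS ?cycle_subG ?groupX // oG -orderE oxr def2q.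
  rewrite mulKn // (@leq_ltn_trans 4) //; last first.
    by rewrite (leq_trans _ (leq_mul (leqnn 2) r_ge4)).
  rewrite (leq_trans _ (leq_mul (oqW y Gy y4) (oqW _ Gxy xy4))) // mul_cardG.
  by rewrite leq_pmulr.
pose A := <<y ^: G>>%G; pose B := <<(x * y) ^: G>>%G.
have Ay : y \in A by rewrite mem_gen ?class_refl.
have Bxy : x * y \in B by rewrite mem_gen ?class_refl.
have maxA : maximal A G by rewrite defmax /= eqxx orbT.
have maxB : maximal B G by rewrite defmax /= eqxx !orbT.
have sFG (M : {group gT}) : maximal M G -> <[x ^+ 2]> \subset M.
  by rewrite -defPhi; apply: Phi_sub_max.
have cardM (M : {group gT}) : maximal M G -> #|M| = (2 * r)%N.
  move=> maxM; apply/eqP; rewrite -(eqn_pmul2l (isT : 0 < 2)) -def2q -oG.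
  rewrite -(Lagrange (proper_sub (maxgroupp maxM))).
  by rewrite (p_maximal_index pG) // mulnC.
(* The intersection contains the Frattini subgroup, of order r, and is proper in M, of order 2r, so
   its order is at most r. *)
have defI (M N : {group gT}) :
    maximal M G -> maximal N G -> ~~ (M \subset N) -> M :&: N = <[x ^+ 2]>.
  move=> maxM maxN sMN; apply/esym/eqP.
  rewrite eqEcard subsetI !sFG //= -orderE ox2 -(leq_pmul2l (isT : 0 < 2)).
  rewrite -(cardM M maxM) -(Lagrange (subsetIl M N)) mulnC.
  by rewrite leq_pmul2l ?cardG_gt0 // indexg_gt1 subsetI subxx.
have gen2 (M : {group gT}) : maximal M G -> y \in M -> x \in M -> False.
  move=> /maxgroupp/andP[_ /negP sGM] My Mx; apply: sGM.
  by rewrite -defXY mulG_subG !cycle_subG Mx.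
have sAX : ~~ (A \subset <[x]>) by apply: contra X_y => /subsetP->.
have sBX : ~~ (B \subset <[x]>).
  by apply: contra X_y => /subsetP/(_ _ Bxy); rewrite groupMl ?cycle_id.
have sAB : ~~ (A \subset B).
  apply/negP=> /subsetP/(_ _ Ay) By; apply: (gen2 B) => //.
  by rewrite -(groupMr _ By).
have [sYA sKB] : <[y]> \subset A /\ <[x * y]> \subset B by rewrite !cycle_subG.
apply: (@not_class_C_cover _ G A B <[x]>%G <[x ^+ 2]>%G).
- exact: maxgroupp maxA.
- exact: maxgroupp maxB.
- exact: maxgroupp maxX.
- by rewrite properEcard cycleX -!orderE ox ox2 ltn_Pmull.
- exact: defI.
- exact: defI.
- exact: defI.
- move=> K /properP[sKG [t Gt K't]].
  have [eKG|[M]] := maximal_exists sKG; first by rewrite eKG Gt in K't.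
  by rewrite defmax => /or3P[] /eqP-> ->; rewrite ?orbT.
- move=> K /properP[sKX [t Xt K't]] /=.
  have cX := cycle_cyclic x.
  (* In a cyclic group, inclusion of subgroups is divisibility of orders. |K| is a power of 2
     dividing 2r, and equality would give K = <x>. *)
  rewrite -(cardSg_cyclic cX sKX (cycleX x 2)) -orderE ox2 def_r.
  have := cardSg sKX; rewrite -orderE ox -def2r => /dvdn_pfactor[//|k].
  rewrite leq_eqVlt => /predU1P[-> oK|lt_k ->]; last by rewrite dvdn_exp2l.
  have eKX : K :=: <[x]>.
    by apply/eqP; rewrite (eq_subG_cyclic cX) // oK -orderE ox def2r.
  by rewrite eKX Xt in K't.
- exact: nsub.
(* The same pair, read in its two orders, serves A (which contains y) and B (which contains xy). *)
- apply/set0Pn; exists (<[y]>%G, <[x * y]>%G); rewrite in_noncommuting_pairs.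
  by rewrite sYA cycle_subG Gxy; apply/eqP.
- apply/set0Pn; exists (<[x * y]>%G, <[y]>%G); rewrite in_noncommuting_pairs.
  by rewrite sKB cycle_subG Gy; apply/eqP => /esym.
(* Three subgroups of F, told apart by their orders 1, 2 and r >= 4. *)
rewrite (@leq_trans #|[1 gT]%G |: [set W; <[x ^+ 2]>%G]|) //.
  rewrite cardsU1 cards2 !inE.
  have ne (H K : {group gT}) : #|H| < #|K| -> H != K.
    by move=> lt; apply: contraTneq lt => ->; rewrite ltnn.
  by rewrite negb_or !ne //= ?cards1 -!orderE ?oxr ?ox2 // (leq_trans _ r_ge4).
apply: subset_leq_card; apply/subsetP=> K; rewrite !inE.
case/or3P=> /eqP-> //; first exact: sub1G.
by rewrite cycle_subG /= def_r expnS expgM mem_cycle.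
Qed.

(** * Groups of order 8 *)

(** Every subgroup is normal: one not inside <x> contains an element of order 4, so its index is 1
    or 2. *)
Lemma not_class_C_Q8 (gT : finGroupType) (G : {group gT}) :
  G \isog 'Q_(2 ^ 3) -> ~ class_C G.
Proof.
move=> isoG; have [[x y] genG _] := generators_quaternion (isT : 2 < 3) isoG.
have [[_ oX' _] _ _ _ _] := quaternion_structure (isT : 2 < 3) genG isoG.
have [_ _ nsXG _ _] := extremal_generators_facts (isT : prime 2) genG.
have [oG _ _ _] := genG.
have nsG (K : {group gT}) : K \subset G -> K <| G.
  move=> sKG; have [sKX|/subsetPn[t Kt X't]] := boolP (K \subset <[x]>).
    by apply: char_normal_trans nsXG; apply: cycle_subgroup_char.
  have /dvdnP[k oK] : 4 %| #|K|.
    by rewrite -(oX' t) ?order_dvdG // !inE X't (subsetP sKG).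
  have := Lagrange sKG; rewrite oG oK mulnAC -[(2 ^ 3)%N]/(2 * 4)%N => /eqP.
  rewrite eqn_pmul2r // => /eqP ki.
  have /(dvdn_pfactor _ 1 (isT : prime 2))[[|[|]] // _ iK] : #|G : K| %| 2 ^ 1.
  - by rewrite -[(2 ^ 1)%N]ki dvdn_mull.
  - by rewrite (index1g sKG iK) normal_refl.
  - exact: index2_normal.
apply: not_class_C_all_commute; apply/setP=> -[K L].
rewrite in_noncommuting_pairs in_set0; apply/and3P=> -[sKG sLG].
by rewrite (normal_mulC (nsG K sKG) sLG) eqxx.
Qed.

(** Conjugation by an element of G permutes L(G) and respects products. Used to bound d(<y>^x) by
    d(<y>) in the dihedral group of order 8. *)
Lemma card_noncommuting_conj (gT : finGroupType) (H G : {group gT}) g :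
  g \in G -> #|noncommuting_pairs (H :^ g)%G G| <= #|noncommuting_pairs H G|.
Proof.
move=> Gg; pose f (P : {group gT} * {group gT}) := ((P.1 :^ g)%G, (P.2 :^ g)%G).
apply: leq_trans (leq_imset_card f _); apply/subset_leq_card/subsetP=> -[K L].
rewrite in_noncommuting_pairs => /and3P[sKH sLG ncKL].
apply/imsetP; exists ((K :^ g^-1)%G, (L :^ g^-1)%G).
  rewrite in_noncommuting_pairs -!conjsMg (inj_eq (@conjsg_inj _ _)) ncKL.
  by rewrite !sub_conjgV sKH conjGid ?sLG.
by congr (_, _); apply/val_inj; rewrite /= conjsgKV.
Qed.

Lemma not_class_C_D8 (gT : finGroupType) (G : {group gT}) :
  G \isog 'D_(2 ^ 3) -> ~ class_C G.
Proof.
move=> isoG CG.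
have [[x y] genG [oy xy]] := generators_2dihedral (isT : 1 < 3) isoG.
have [[_ oX' _] [defG' _ _ _] _ _ _] :=
  dihedral2_structure (isT : 1 < 3) genG isoG.
have [_ _ nsXG defXY _] := extremal_generators_facts (isT : prime 2) genG.
have [oG Gx ox X'y] := genG; have [Gy X_y] := setDP X'y.
set z := x ^+ 2 in defG'; have oz : #[z] = 2 by rewrite orderXdiv ox.
have Gxy : x * y \in G by rewrite groupM.
(* Hence the conjugate [Yx] is <yz>, the third subgroup of order 2 in the Klein group V, beside Y
   and Z. *)
have yx : y ^ x = y * z.
  rewrite /z expgS expg1 conjgE mulgA (conjgC x^-1) conjVg xy invgK.
  by rewrite mulgA.
pose Y := <[y]>%G; pose Z := <[z]>%G; pose Yx := (Y :^ x)%G.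
have sZG : Z \subset G by rewrite cycle_subG groupX.
have sYG : Y \subset G by rewrite cycle_subG.
have nsZG : Z <| G by apply: sub_der1_normal; rewrite ?defG'.
have nYZ : Y \subset 'N(Z) by apply: subset_trans sYG (normal_norm nsZG).
pose V := (Y <*> Z)%G.
have defV : V = Y * Z :> {set gT} by rewrite /= norm_joinEl.
have tiYZ : Y :&: Z = 1.
  rewrite prime_TIg -?orderE ?oy // cycle_subG.
  by apply: contra X_y => /(subsetP (cycleX x 2)).
have memY a : a \in Y -> a = 1 \/ a = y.
  by rewrite /= cycle2g // !inE => /pred2P.
have memZ b : b \in Z -> b = 1 \/ b = z.
  by rewrite /= cycle2g // !inE => /pred2P.
have oV : #|V| = 4 by rewrite defV TI_cardMg // -!orderE oy oz.
have sVG : V \subset G by rewrite join_subG sYG.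
have sYV : Y \subset V by apply: joing_subl.
have sZV : Z \subset V by apply: joing_subr.
have ncY : noncommuting_pairs Y G != set0.
  apply/set0Pn; exists (Y, <[x * y]>%G); rewrite in_noncommuting_pairs.
  rewrite subxx cycle_subG Gxy; apply/eqP=> cYK.
  move/cycle_mul_comm_sub: cYK; rewrite defXY.
  move/subset_leq_card; rewrite leqNgt oG => /negP[].
  (* Two subgroups of order 2 have a product of at most 4 elements, too few to cover G. *)
  rewrite (@leq_ltn_trans (#|Y| * #|<[x * y]>|)) //.
    by rewrite mul_cardG leq_pmulr.
  by rewrite -!orderE oy oX' // !inE groupMl ?cycle_id // X_y.
have ncV : noncommuting_pairs V G != set0.
  by apply: contraNneq ncY => e; rewrite -subset0 -e noncommuting_pairsS.
have LY : #|subgroups Y| <= 2.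
  rewrite (@leq_trans #|[set [1 gT]%G; Y]|) //; last first.
    by rewrite cards2; case: (_ != _).
  apply/subset_leq_card/subsetP=> K; rewrite !inE => sKY.
  have : #|K| %| 2 by rewrite -oy orderE cardSg.
  case/(dvdn_pfactor _ 1 (isT : prime 2)) => [[|[|]] // _ oK].
    by apply/orP; left; apply/eqP/val_inj/card1_trivg.
  by apply/orP; right; rewrite -val_eqE eqEcard sKY -orderE oy oK.
have eYx : <[y * z]> = Yx by rewrite -yx cycleJ.
have sYxV : Yx \subset V.
  by rewrite -eYx cycle_subG groupM // -cycle_subG.
have oYx : #|Yx| = 2 by rewrite cardJg -orderE.
have LV : 4 < #|subgroups V|.
  pose s := [:: [1 gT]%G; Z; Y; Yx; V].
  have us : uniq s.
    have ne (H K : {group gT}) : #|H| < #|K| -> (H == K) = false.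
      by move=> lt; apply: contraTF lt => /eqP->; rewrite ltnn.
    have neE (H K : {group gT}) t : t \in K -> t \notin H -> (H == K) = false.
      by move=> Kt; apply: contraNF => /eqP->.
    have zY : z \notin Y.
      apply/negP=> Yz; have : z \in Y :&: Z by rewrite inE Yz cycle_id.
      by rewrite tiYZ inE -order_eq1 oz.
    have yzZ : y * z \notin Z.
      rewrite groupMr ?cycle_id //; apply: contra X_y.
      exact: subsetP (cycleX x 2) y.
    have yZ : y \notin Z by rewrite -(groupMr _ (cycle_id z)).
    have yzY : y * z \notin Y by rewrite groupMl ?cycle_id.
    have Yxyz : y * z \in Yx by rewrite -eYx cycle_id.
    (* Elements separate the three subgroups of order 2; orders settle the remaining comparisons. *)
    rewrite /s !cons_uniq !inE (neE Z Y y) ?cycle_id //.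
    rewrite (neE Z Yx (y * z)) // (neE Y Yx (y * z)) //.
    by rewrite !ne ?oV ?oYx ?cards1 -?orderE ?oy ?oz.
  rewrite -[5]/(size s) -(card_uniqP us); apply/subset_leq_card/subsetP=> K.
  by rewrite !inE => /or4P[|||/orP[]] /eqP->; rewrite ?sub1G.
(* A subgroup of V containing z contains G' and is normal, so it permutes with everything. Any other
   subgroup of V lies in Y or in its conjugate [Yx]. *)
have DV : #|noncommuting_pairs V G| <= 2 * #|noncommuting_pairs Y G|.
  rewrite mul2n -addnn.
  set dY := #|noncommuting_pairs Y G|.
  apply: (@leq_trans (dY + #|noncommuting_pairs Yx G|)); last first.
    by rewrite leq_add2l card_noncommuting_conj.
  apply: leq_trans (leq_card_setU _ _).
  apply/subset_leq_card/subsetP=> -[K L].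
  rewrite in_setU !in_noncommuting_pairs => /and3P[sKV sLG ncKL].
  rewrite sLG ncKL !andbT; apply/orP.
  have zK : z \notin K.
    apply: contra ncKL => zK; apply/eqP/(normal_mulC (G := G)) => //.
    apply: sub_der1_normal; last exact: subset_trans sVG.
    by rewrite defG' cycle_subG.
  have KZ b : b \in Z -> b \in K -> b = 1.
    by move=> /memZ[] // -> zK'; rewrite zK' in zK.
  have [yK|y'K] := boolP (y \in K); [left|right].
    apply/subsetP=> k Kk; have := subsetP sKV k Kk; rewrite defV.
    case/mulsgP=> a b Ya Zb kab; rewrite kab.
    have Ka : a \in K by move: Ya; apply: subsetP; rewrite cycle_subG.
    by rewrite (KZ b) ?mulg1 // -(groupMl _ Ka) -kab.
  apply/subsetP=> k Kk; have := subsetP sKV k Kk; rewrite defV.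
  case/mulsgP=> a b /memY[]-> /memZ[]-> kab.
  - by rewrite kab mulg1 group1.
  - by rewrite -[z]mul1g -kab Kk in zK.
  - by rewrite -[y]mulg1 -kab Kk in y'K.
  by rewrite kab -eYx cycle_id.
have := class_C_eq CG sYG sVG ncY ncV; apply/eqP.
rewrite neq_ltn; apply/orP; right.
(* d(V) |L(Y)| <= 4 d(Y) < d(Y) |L(V)|, contradicting the proportion. *)
apply: leq_ltn_trans (leq_mul DV LY) _.
by rewrite mulnAC mulnC ltn_pmul2l ?card_gt0.
Qed.

(** * The three families *)

Theorem corollary3p2 (gT : finGroupType) (G : {group gT}) (n : nat) :
  [/\ (3 <= n)%N ->
      G \isog Grp (x : y : x ^+ (2 ^ (n - 1)) = y ^+ 2 = 1,
                           y * x * y^-1 = x ^+ (2 ^ (n - 1) - 1)) ->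
      ~ class_C G,
      (3 <= n)%N ->
      G \isog Grp (x : y : x ^+ (2 ^ (n - 1)) = y ^+ 4 = 1,
                           x ^+ (2 ^ (n - 2)) = y ^+ 2,
                           y * x * y^-1 = x ^+ (2 ^ (n - 1) - 1)) ->
      ~ class_C G
    & (4 <= n)%N ->
      G \isog Grp (x : y : x ^+ (2 ^ (n - 1)) = y ^+ 2 = 1,
                           y^-1 * x * y = x ^+ (2 ^ (n - 2) - 1)) ->
      ~ class_C G].
Proof.
(* In the dihedral and quaternion cases all elements outside <x> have the same order, so this
   handles xy along with y. *)
have X'xy (x y : gT) : y \in G :\: <[x]> -> x \in G -> x * y \in G :\: <[x]>.
  by rewrite !inE => /andP[X_y Gy] Gx; rewrite groupMl ?cycle_id // X_y groupM.
split=> n_ge isoP.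
- have := isog_dihedral n_ge isoP.
  case: (ltngtP n 3) n_ge => // [n_gt3 _ isoG|-> _]; last exact: not_class_C_D8.
  have n_gt1 : 1 < n by rewrite (ltn_trans _ n_gt3).
  have [[x y] genG _] := generators_2dihedral n_gt1 isoG.
  have [[_ oX' _] [defG' defPhi _ _] _ [_ _ defmax] _] :=
    dihedral2_structure n_gt1 genG isoG.
  have [_ Gx _ X'y] := genG.
  apply: not_class_C_extremal n_gt3 genG _ _ _ defmax; last by rewrite defPhi.
    by apply/eqP; rewrite -order_dvdn oX'.
  by apply/eqP; rewrite -order_dvdn oX' ?X'xy.
- have := isog_quaternion n_ge isoP.
  case: (ltngtP n 3) (n_ge) => // [n_gt3 _ isoG|-> _]; last first.
    exact: not_class_C_Q8.
  have [[x y] genG _] := generators_quaternion n_ge isoG.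
  have [[_ oX' _] [defG' defPhi _ _] _ [_ defmax] _] :=
    quaternion_structure n_ge genG isoG.
  have [_ Gx _ X'y] := genG.
  apply: not_class_C_extremal n_gt3 genG _ _ _ defmax; last by rewrite defPhi.
    by apply/eqP; rewrite -order_dvdn oX'.
  by apply/eqP; rewrite -order_dvdn oX' ?X'xy.
have isoG := isog_semidihedral n_ge isoP.
have [[x y] genG [oy _]] := generators_semidihedral n_ge isoG.
have [[_ oxy _] [defG' defPhi _ _] _ [_ defmax] _] :=
  semidihedral_structure n_ge genG isoG oy.
apply: not_class_C_extremal n_ge genG _ _ _ defmax; last by rewrite defPhi.
  by apply/eqP; rewrite -order_dvdn oy.
by apply/eqP; rewrite -order_dvdn oxy.
Qed.
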